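(* Let $L\ge 1$ be an integer, $P>0$, $w_0,w_1,w_2>0$, and for $i\in\{1,2\}$, $\ell\in\{1,\dots,L\}$ let $0<\alpha_{i,\ell}^-\le\alpha_{i,\ell}^+$ be real numbers. Let the sets $\mathcal P,S_1,S_2,S_3$, the functions $R_{01}^{\max},R_{02}^{\max},R_1^{\max},R_2^{\max}$, and the quantities $\beta_{i,\ell},\gamma_{i,\ell},\zeta_{i,\ell},\nu_{i,\ell},\theta_{i,\ell},\Lambda_{i,\ell},\xi_{i,\ell}$ (some depending on a parameter $\lambda>0$ and on $\mu\in(0,1)$) be as defined in the context. Consider the three problems $$\textbf{(P1)}\quad \max_{\boldsymbol{p}\in\mathcal P}\ w_0R_{01}^{\max}(\boldsymbol{p})+w_1R_1^{\max}(\boldsymbol{p})+w_2R_2^{\max}(\boldsymbol{p}),$$ $$\textbf{(P2)}\quad \max_{\boldsymbol{p}\in\mathcal P}\ w_0R_{02}^{\max}(\boldsymbol{p})+w_1R_1^{\max}(\boldsymbol{p})+w_2R_2^{\max}(\boldsymbol{p}),$$ $$\textbf{(P3)}\quad \max_{\boldsymbol{p}\in\mathcal P}\ w_0\big(\mu R_{01}^{\max}(\boldsymbol{p})+(1-\mu)R_{02}^{\max}(\boldsymbol{p})\big)+w_1R_1^{\max}(\boldsymbol{p})+w_2R_2^{\max}(\boldsymbol{p}),\qquad \mu\in(0,1).$$ In the allocations below, every component not explicitly specified is $0$ (that is, $p_{2,\ell}=0$ for $\ell\in S_1$, $p_{1,\ell}=0$ for $\ell\in S_2$, $p_{1,\ell}=p_{2,\ell}=0$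 for $\ell\in S_3$). **(P1)** A solution (maximizer) of (P1) is the vector $\boldsymbol{p}^{(1)}$ given as follows, where $\lambda>0$ is chosen so that $\sum_{\ell=1}^L(p^{(1)}_{0,\ell}+p^{(1)}_{1,\ell}+p^{(1)}_{2,\ell})=P$ (such a $\lambda$ can be found). - For $\ell\in S_1$: if $\frac{w_1}{w_0}>\frac{\alpha_{1,\ell}^-}{\alpha_{1,\ell}^--\alpha_{2,\ell}^+}$, then $p^{(1)}_{0,\ell}=[\gamma_{1,\ell}-\zeta_{1,\ell}]^+$ and $p^{(1)}_{1,\ell}=[\min\{\beta_{1,\ell},\zeta_{1,\ell}\}]^+$; otherwise $p^{(1)}_{0,\ell}=[\gamma_{1,\ell}]^+$ and $p^{(1)}_{1,\ell}=0$. - For $\ell\in S_2$: if $\frac{w_2}{w_0}>\frac{\alpha_{1,\ell}^-}{\alpha_{2,\ell}^--\alpha_{1,\ell}^+}$, then $p^{(1)}_{0,\ell}=[\gamma_{1,\ell}-\theta_{2,\ell}]^+$ and $p^{(1)}_{2,\ell}=[\min\{\beta_{2,\ell},\theta_{2,\ell}\}]^+$; otherwise $p^{(1)}_{0,\ell}=[\gamma_{1,\ell}]^+$ and $p^{(1)}_{2,\ell}=0$. - For $\ell\in S_3$: $p^{(1)}_{0,\ell}=[\gamma_{1,\ell}]^+$. **(P2)** A solution of (P2) is the vector $\boldsymbol{p}^{(2)}$ obtained from the formulas for $\boldsymbol{p}^{(1)}$ by swapping the user indices $1$ and $2$, where $\lambda>0$ is chosen so that $\sum_{\ell=1}^L(p^{(2)}_{0,\ell}+p^{(2)}_{1,\ell}+p^{(2)}_{2,\ell})=P$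 (such a $\lambda$ can be found). Explicitly: - For $\ell\in S_2$: if $\frac{w_2}{w_0}>\frac{\alpha_{2,\ell}^-}{\alpha_{2,\ell}^--\alpha_{1,\ell}^+}$, then $p^{(2)}_{0,\ell}=[\gamma_{2,\ell}-\zeta_{2,\ell}]^+$ and $p^{(2)}_{2,\ell}=[\min\{\beta_{2,\ell},\zeta_{2,\ell}\}]^+$; otherwise $p^{(2)}_{0,\ell}=[\gamma_{2,\ell}]^+$ and $p^{(2)}_{2,\ell}=0$. - For $\ell\in S_1$: if $\frac{w_1}{w_0}>\frac{\alpha_{2,\ell}^-}{\alpha_{1,\ell}^--\alpha_{2,\ell}^+}$, then $p^{(2)}_{0,\ell}=[\gamma_{2,\ell}-\theta_{1,\ell}]^+$ and $p^{(2)}_{1,\ell}=[\min\{\beta_{1,\ell},\theta_{1,\ell}\}]^+$; otherwise $p^{(2)}_{0,\ell}=[\gamma_{2,\ell}]^+$ and $p^{(2)}_{1,\ell}=0$. - For $\ell\in S_3$: $p^{(2)}_{0,\ell}=[\gamma_{2,\ell}]^+$. **(P3)** Let $\boldsymbol{p}^{(3)}$ be given by the formulas below, where $\lambda>0$ and $\mu\in(0,1)$ are such that $\sum_{\ell=1}^L(p^{(3)}_{0,\ell}+p^{(3)}_{1,\ell}+p^{(3)}_{2,\ell})=P$ and $R_{01}^{\max}(\boldsymbol{p}^{(3)})=R_{02}^{\max}(\boldsymbol{p}^{(3)})$. Then $\boldsymbol{p}^{(3)}$ is a solution of (P3) for this $\mu$. For $i\in\{1,2\}$ and $\ell\in S_i$: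 - If $\Lambda_{i,\ell}>0$: if $\frac{w_i}{w_0}>\frac{\mu_i\alpha_{i,\ell}^-+\mu_{\bar\imath}\alpha_{\bar\imath,\ell}^-}{\alpha_{i,\ell}^--\alpha_{\bar\imath,\ell}^+}$, then $p^{(3)}_{0,\ell}=[\nu_{i,\ell}-\xi_{i,\ell}]^+$ and $p^{(3)}_{i,\ell}=[\min\{\beta_{i,\ell},\xi_{i,\ell}\}]^+$; otherwise $p^{(3)}_{0,\ell}=[\nu_{i,\ell}]^+$ and $p^{(3)}_{i,\ell}=0$. - If $\Lambda_{i,\ell}=0$: if $\frac{w_i}{w_0}>\frac{\alpha_{i,\ell}^-+\mu_{\bar\imath}\alpha_{\bar\imath,\ell}^++\mu_i\,\alpha_{i,\ell}^-\alpha_{\bar\imath,\ell}^+/\alpha_{\bar\imath,\ell}^-}{\alpha_{i,\ell}^--\alpha_{\bar\imath,\ell}^+}$, then $p^{(3)}_{0,\ell}=[\nu_{i,\ell}-\xi_{i,\ell}]^+$ and $p^{(3)}_{i,\ell}=[\min\{\beta_{i,\ell},\xi_{i,\ell}\}]^+$; otherwise $p^{(3)}_{0,\ell}=[\nu_{i,\ell}]^+$ and $p^{(3)}_{i,\ell}=0$. - If $\Lambda_{i,\ell}<0$: if $\frac{w_i}{w_0}>\frac{\mu_i\alpha_{i,\ell}^-+\mu_{\bar\imath}\alpha_{\bar\imath,\ell}^-}{\alpha_{i,\ell}^--\alpha_{\bar\imath,\ell}^+}$, then $p^{(3)}_{0,\ell}=0$ and $p^{(3)}_{i,\ell}=[\beta_{i,\ell}]^+$;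 otherwise $p^{(3)}_{0,\ell}=[\nu_{i,\ell}]^+$ and $p^{(3)}_{i,\ell}=0$. For $\ell\in S_3$: $p^{(3)}_{0,\ell}=[\nu_{1,\ell}]^+$.
   Context: Setting: power allocation over $L$ parallel Gaussian sub-channels for a two-user broadcast channel with one common message (index $0$) and two confidential messages (indices $1,2$). The numbers $\alpha_{i,\ell}^-$ and $\alpha_{i,\ell}^+$ are lower and upper bounds on the power gain of user $i$ on sub-channel $\ell$. Notation: $\log$ is base 2, $\ln$ is natural, $[x]^+=\max\{x,0\}$. For $i\in\{1,2\}$, $\bar\imath=3-i$ is the other index. For $\mu\in(0,1)$, $\mu_1=\mu$ and $\mu_2=1-\mu$. Power allocation vectors are $\boldsymbol{p}=[p_{0,1},\dots,p_{0,L},p_{1,1},\dots,p_{1,L},p_{2,1},\dots,p_{2,L}]$ with nonnegative real entries, and $$\mathcal P=\Big\{\boldsymbol{p}\ge 0:\ \sum_{\ell=1}^L(p_{0,\ell}+p_{1,\ell}+p_{2,\ell})\le P\Big\}.$$ Partition of sub-channels: $S_1=\{\ell:\alpha_{1,\ell}^->\alpha_{2,\ell}^+\}$, $S_2=\{\ell:\alpha_{2,\ell}^->\alpha_{1,\ell}^+\}$, $S_3=\{1,\dots,L\}\setminus(S_1\cup S_2)$. Rates: for $i\in\{1,2\}$, $$R_{0i}^{\max}(\boldsymbol{p})=\frac12\sum_{\ell=1}^L\Big[\log\big(1+\alpha_{i,\ell}^-(p_{0,\ell}+p_{1,\ell}+p_{2,\ell})\big)-\log\big(1+\alpha_{i,\ell}^-(p_{1,\ell}+p_{2,\ell})\big)\Big],$$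 $$R_i^{\max}(\boldsymbol{p})=\frac12\sum_{\ell\in S_i}\Big[\log(1+\alpha_{i,\ell}^-p_{i,\ell})-\log(1+\alpha_{\bar\imath,\ell}^+p_{i,\ell})\Big].$$ Auxiliary quantities, for a parameter $\lambda>0$ (and $\mu\in(0,1)$ where $\mu_i$ appears): $$\delta_{i,\ell}=\frac1{\alpha_{\bar\imath,\ell}^+}-\frac1{\alpha_{i,\ell}^-},$$ $$\beta_{i,\ell}=\frac12\Big[\delta_{i,\ell}\Big(\delta_{i,\ell}+\frac{2w_i}{\lambda\ln2}\Big)\Big]^{1/2}-\frac12\Big(\frac1{\alpha_{\bar\imath,\ell}^+}+\frac1{\alpha_{i,\ell}^-}\Big),$$ $$\gamma_{i,\ell}=\frac{w_0}{2\lambda\ln2}-\frac1{\alpha_{i,\ell}^-},\qquad \zeta_{i,\ell}=\frac{w_i}{w_0}\delta_{i,\ell}-\frac1{\alpha_{\bar\imath,\ell}^+},$$ $$\nu_{i,\ell}=\frac12\Big[\Big(\frac1{\alpha_{\bar\imath,\ell}^-}-\frac1{\alpha_{i,\ell}^-}-\frac{w_0}{2\lambda\ln2}\Big)^2+\frac{2w_0\mu_i}{\lambda\ln2}\Big(\frac1{\alpha_{\bar\imath,\ell}^-}-\frac1{\alpha_{i,\ell}^-}\Big)\Big]^{1/2}-\frac12\Big(\frac1{\alpha_{\bar\imath,\ell}^-}+\frac1{\alpha_{i,\ell}^-}-\frac{w_0}{2\lambda\ln2}\Big),$$ $$\Delta_{i,\ell}=\left[\Big(\frac{w_i}{w_0}\Big)^2+\frac{w_i}{w_0}\cdot\frac{2\big(\frac2{\alpha_{\bar\imath,\ell}^-}-\frac1{\alpha_{i,\ell}^-}-\frac1{\alpha_{\bar\imath,\ell}^+}\big)}{\frac1{\alpha_{\bar\imath,\ell}^+}-\frac1{\alpha_{i,\ell}^-}}+1\right]\Big[\frac1{\alpha_{\bar\imath,\ell}^+}-\frac1{\alpha_{i,\ell}^-}\Big]^2,$$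 $$\theta_{i,\ell}=\frac12\Big[\frac{w_i}{w_0}\Big(\frac1{\alpha_{\bar\imath,\ell}^+}-\frac1{\alpha_{i,\ell}^-}\Big)-\Big(\frac1{\alpha_{\bar\imath,\ell}^+}+\frac1{\alpha_{i,\ell}^-}\Big)+\sqrt{\Delta_{i,\ell}}\Big],$$ $$\Lambda_{i,\ell}=\delta_{i,\ell}^2\Big(\frac{w_i}{w_0}\Big)^2+2\frac{w_i}{w_0}\delta_{i,\ell}\Big(\frac{2-\mu_i}{\alpha_{\bar\imath,\ell}^-}-\frac{\mu_{\bar\imath}}{\alpha_{i,\ell}^-}-\frac1{\alpha_{\bar\imath,\ell}^+}\Big)+\delta_{i,\ell}^2+\mu_i\Big(\frac1{\alpha_{\bar\imath,\ell}^-}-\frac1{\alpha_{i,\ell}^-}\Big)\Big[\mu_i\Big(\frac1{\alpha_{\bar\imath,\ell}^-}-\frac1{\alpha_{i,\ell}^-}\Big)-2\Big(\frac1{\alpha_{\bar\imath,\ell}^+}-\frac1{\alpha_{i,\ell}^-}\Big)\Big],$$ $$\xi_{i,\ell}=\frac12\Big[\frac{w_i}{w_0}\delta_{i,\ell}-\Big(\frac1{\alpha_{\bar\imath,\ell}^+}+\frac1{\alpha_{i,\ell}^-}\Big)-\mu_i\Big(\frac1{\alpha_{\bar\imath,\ell}^-}-\frac1{\alpha_{i,\ell}^-}\Big)+\sqrt{\Lambda_{i,\ell}}\Big]\quad(\text{used only when }\Lambda_{i,\ell}\ge0).$$ The quantities $\beta_{i,\ell},\zeta_{i,\ell},\Delta_{i,\ell},\theta_{i,\ell},\Lambda_{i,\ell},\xi_{i,\ell}$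 are used only for $\ell\in S_i$, where $\delta_{i,\ell}>0$. *)

(* Defs.v *)
From HB Require Import structures.
From mathcomp Require Import all_boot all_order all_algebra.
From mathcomp Require Import reals exp.

Set Implicit Arguments.
Unset Strict Implicit.
Unset Printing Implicit Defensive.

Import Order.TTheory GRing.Theory Num.Theory.
Local Open Scope ring_scope.

Inductive user := User1 | User2.

(* i |-> 3 - i *)
Definition other (i : user) : user :=
  match i with User1 => User2 | User2 => User1 end.

(* [common p l], [conf p User1 l] and [conf p User2 l] are the powers
   p_{0,l}, p_{1,l} and p_{2,l}. *)
Record power_vector (R : realType) (L : nat) := PowerVector {
  common : 'I_L -> R;
  conf : user -> 'I_L -> R }.

Definition log2 (R : realType) (x : R) : R := ln x / ln 2%:R.

Definition pos (R : realType) (x : R) : R := Num.max x 0.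

Definition mu_ (R : realType) (mu : R) (i : user) : R :=
  match i with User1 => mu | User2 => 1 - mu end.

Definition total_power (R : realType) (L : nat) (p : power_vector R L) : R :=
  \sum_(l < L) (common p l + conf p User1 l + conf p User2 l).

Definition feasible (R : realType) (L : nat) (P : R) (p : power_vector R L) :=
  (forall l, 0 <= common p l) /\ (forall i l, 0 <= conf p i l) /\
  total_power p <= P.

Definition is_solution (R : realType) (L : nat) (P : R)
    (f : power_vector R L -> R) (p : power_vector R L) :=
  feasible P p /\ forall q, feasible P q -> f q <= f p.

Section Allocation.
(* am and ap are the lower and upper bounds on the power gains. *)
Variables (R : realType) (L : nat) (am ap : user -> 'I_L -> R).

(* better User1 and better User2 are S_1 and S_2; S_3 is the complement of
   their union. *)
Definition better (i : user) : {set 'I_L} := [set l | ap (other i) l < am i l].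

Definition R0max (i : user) (p : power_vector R L) : R :=
  2^-1 * \sum_(l < L)
    (log2 (1 + am i l * (common p l + conf p User1 l + conf p User2 l))
     - log2 (1 + am i l * (conf p User1 l + conf p User2 l))).

Definition Rmax (i : user) (p : power_vector R L) : R :=
  2^-1 * \sum_(l in better i)
    (log2 (1 + am i l * conf p i l) - log2 (1 + ap (other i) l * conf p i l)).

Variables (w0 : R) (w : user -> R).

Definition obj1 (p : power_vector R L) : R :=
  w0 * R0max User1 p + w User1 * Rmax User1 p + w User2 * Rmax User2 p.

Definition obj2 (p : power_vector R L) : R :=
  w0 * R0max User2 p + w User1 * Rmax User1 p + w User2 * Rmax User2 p.

Definition obj3 (mu : R) (p : power_vector R L) : R :=
  w0 * (mu * R0max User1 p + (1 - mu) * R0max User2 p)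
  + w User1 * Rmax User1 p + w User2 * Rmax User2 p.

Definition delta (i : user) (l : 'I_L) : R := (ap (other i) l)^-1 - (am i l)^-1.

Definition beta (lam : R) (i : user) (l : 'I_L) : R :=
  2^-1 * Num.sqrt (delta i l * (delta i l + 2 * w i / (lam * ln 2%:R)))
  - 2^-1 * ((ap (other i) l)^-1 + (am i l)^-1).

Definition gamma (lam : R) (i : user) (l : 'I_L) : R :=
  w0 / (2 * lam * ln 2%:R) - (am i l)^-1.

Definition zeta (i : user) (l : 'I_L) : R :=
  w i / w0 * delta i l - (ap (other i) l)^-1.

Definition nu (lam mu : R) (i : user) (l : 'I_L) : R :=
  let d := (am (other i) l)^-1 - (am i l)^-1 in
  2^-1 * Num.sqrt ((d - w0 / (2 * lam * ln 2%:R)) ^+ 2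
                   + 2 * w0 * mu_ mu i / (lam * ln 2%:R) * d)
  - 2^-1 * ((am (other i) l)^-1 + (am i l)^-1 - w0 / (2 * lam * ln 2%:R)).

Definition Delta (i : user) (l : 'I_L) : R :=
  ((w i / w0) ^+ 2
   + w i / w0
     * (2 * (2 / am (other i) l - (am i l)^-1 - (ap (other i) l)^-1)
        / ((ap (other i) l)^-1 - (am i l)^-1))
   + 1) * ((ap (other i) l)^-1 - (am i l)^-1) ^+ 2.

Definition theta (i : user) (l : 'I_L) : R :=
  2^-1 * (w i / w0 * ((ap (other i) l)^-1 - (am i l)^-1)
          - ((ap (other i) l)^-1 + (am i l)^-1) + Num.sqrt (Delta i l)).

Definition Lambda (mu : R) (i : user) (l : 'I_L) : R :=
  let d := (am (other i) l)^-1 - (am i l)^-1 in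
  delta i l ^+ 2 * (w i / w0) ^+ 2
  + 2 * (w i / w0) * delta i l
    * ((2 - mu_ mu i) / am (other i) l - mu_ mu (other i) / am i l
       - (ap (other i) l)^-1)
  + delta i l ^+ 2
  + mu_ mu i * d
    * (mu_ mu i * d - 2 * ((ap (other i) l)^-1 - (am i l)^-1)).

Definition xi (mu : R) (i : user) (l : 'I_L) : R :=
  2^-1 * (w i / w0 * delta i l - ((ap (other i) l)^-1 + (am i l)^-1)
          - mu_ mu i * ((am (other i) l)^-1 - (am i l)^-1)
          + Num.sqrt (Lambda mu i l)).

(* S_1 and S_2 are disjoint when am <= ap, so the order of the tests is
   immaterial. *)
Definition by_part (f : user -> 'I_L -> R) (g : 'I_L -> R) (l : 'I_L) : R :=
  if l \in better User1 then f User1 l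
  else if l \in better User2 then f User2 l
  else g l.

(* The confidential power p_{i,l} is f i l on S_i and 0 elsewhere. *)
Definition on_own_part (f : user -> 'I_L -> R) (i : user) (l : 'I_L) : R :=
  if l \in better i then f i l else 0.

(* The solutions of the first two problems are exchanged by swapping users:
   the one for the objective with R0max j uses zeta on S_j and theta on S_i
   with i = 3 - j, and its threshold on either set has numerator am j l. *)
Definition crossing (j i : user) (l : 'I_L) : R :=
  match j, i with
  | User1, User1 | User2, User2 => zeta i l
  | User1, User2 | User2, User1 => theta i l
  end.

Definition above (j i : user) (l : 'I_L) : bool :=
  am j l / (am i l - ap (other i) l) < w i / w0.

Definition alloc (j : user) (lam : R) : power_vector R L := PowerVector
  (by_part
    (fun i l => if above j i l then pos (gamma lam j l - crossing j i l)
                else pos (gamma lam j l))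
    (fun l => pos (gamma lam j l)))
  (on_own_part
    (fun i l => if above j i l then pos (Num.min (beta lam i l) (crossing j i l))
                else 0)).

Definition above_mu (mu : R) (i : user) (l : 'I_L) : bool :=
  (mu_ mu i * am i l + mu_ mu (other i) * am (other i) l)
    / (am i l - ap (other i) l) < w i / w0.

Definition above_mu0 (mu : R) (i : user) (l : 'I_L) : bool :=
  (am i l + mu_ mu (other i) * ap (other i) l
   + mu_ mu i * (am i l * ap (other i) l / am (other i) l))
    / (am i l - ap (other i) l) < w i / w0.

Definition alloc3 (lam mu : R) : power_vector R L := PowerVector
  (by_part
    (fun i l =>
      if 0 < Lambda mu i l then
        if above_mu mu i l then pos (nu lam mu i l - xi mu i l)
        else pos (nu lam mu i l)
      else if Lambda mu i l == 0 then
        if above_mu0 mu i l then pos (nu lam mu i l - xi mu i l)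
        else pos (nu lam mu i l)
      else
        if above_mu mu i l then 0 else pos (nu lam mu i l))
    (fun l => pos (nu lam mu User1 l)))
  (on_own_part
    (fun i l =>
      if 0 < Lambda mu i l then
        if above_mu mu i l then pos (Num.min (beta lam i l) (xi mu i l)) else 0
      else if Lambda mu i l == 0 then
        if above_mu0 mu i l then pos (Num.min (beta lam i l) (xi mu i l)) else 0
      else
        if above_mu mu i l then pos (beta lam i l) else 0)).

End Allocation.

(* Main.v *)
Require Import Defs.
From HB Require Import structures.
From mathcomp Require Import all_boot all_order all_algebra.
From mathcomp Require Import reals exp.
From mathcomp Require Import boolp classical_sets functions topology normedtype.
From mathcomp Require Import derive realfun.
From mathcomp Require Import ring lra.

Import Order.TTheory GRing.Theory Num.Theory.
Import numFieldNormedType.Exports.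
Local Open Scope ring_scope.

(* Lagrangian sufficiency: a feasible allocation that spends exactly P and
   maximizes [objective - lambda * power] sub-channel by sub-channel is optimal,
   even though the objective is not concave.  On a sub-channel of S_i the power
   of the other confidential message is better moved to the common one, and in
   terms of s = p_0 + p_i and p = p_i the Lagrangian splits as G(s) + H(p) on
   0 <= p <= s.  The functions G, H and G + H are all strictly unimodal, since
   their derivatives have the signs of quadratics with at most one positive root,
   with peaks at nu (or gamma), at xi (or 0 below the threshold), and at beta.
   If the peak of G precedes that of H, the maximum lies on the diagonal p = s;
   otherwise s and p attain their peaks independently.  The problems (P1) and
   (P2) are (P3) at mu = 1 and mu = 0, where xi becomes zeta or theta; and
   Lambda > 0 always holds, because
   1/alpha_{other i}^- >= 1/alpha_{other i}^+ > 1/alpha_i^-.  For the existence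
   of lambda, the spent power is continuous in x = 1/lambda, vanishes at x = 0
   and is unbounded. *)

(** * Positive parts and strictly unimodal functions *)

Lemma pos_ge0 (R : realType) (x : R) : 0 <= pos x.
Proof. by rewrite le_max lexx orbT. Qed.

Lemma pos_le0 (R : realType) (x : R) : x <= 0 -> pos x = 0.
Proof. exact: max_r. Qed.

Lemma pos_id (R : realType) (x : R) : 0 <= x -> pos x = x.
Proof. exact: max_l. Qed.

(* Strict unimodality on [0, +oo); x may be negative, and f is then decreasing. *)
Definition peak {R : realType} (f : R -> R) (x : R) : Prop :=
  forall u v, 0 <= u -> u < v ->
    (v <= x -> f u < f v) /\ (x <= u -> f v < f u).

Lemma peak_incr {R : realType} {f : R -> R} {x u v : R} :
  peak f x -> 0 <= u -> u <= v -> v <= x -> f u <= f v.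
Proof.
move=> fx u0; rewrite le_eqVlt => /orP[/eqP -> //|uv] vx.
by apply/ltW/(fx u v u0 uv).1.
Qed.

Lemma peak_decr {R : realType} {f : R -> R} {x u v : R} :
  peak f x -> 0 <= u -> u <= v -> x <= u -> f v <= f u.
Proof.
move=> fx u0; rewrite le_eqVlt => /orP[/eqP -> //|uv] xu.
by apply/ltW/(fx u v u0 uv).2.
Qed.

Lemma peak_max {R : realType} {f : R -> R} {x u : R} :
  peak f x -> 0 <= u -> f u <= f (pos x).
Proof.
move=> fx u0; have [x0|x0] := leP x 0.
  by rewrite pos_le0 //; apply: (peak_decr fx).
rewrite (pos_id _ _ (ltW x0)).
have [ux|xu] := leP u x; first exact: (peak_incr fx).
by apply: (peak_decr fx) => //; exact: ltW.
Qed.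

(** If [t <= g], the constraint [p <= s] does not bind, and [s = g], [p = t] maximize the two terms
    separately. If [g < t], every point is dominated by one on the diagonal: lower [s] to [p] when
    [p > t], raise [p] to [s] when [s <= t], and otherwise move both to [t]. On the diagonal the
    value is [D], with peak [b]. *)
Lemma peak_split_max {R : realType} {G H D : R -> R} {g t b s p : R} :
  peak G g -> peak H t -> peak D b -> (forall x, D x = G x + H x) ->
  0 <= t -> 0 <= p -> p <= s ->
  G s + H p <= G (pos (Num.min b t) + pos (g - t)) + H (pos (Num.min b t)).
Proof.
move=> Gg Ht Db DE t0 p0 ps; have s0 := le_trans p0 ps.
have HT x : 0 <= x -> H x <= H t.
  by move=> x0; rewrite -(pos_id _ _ t0); exact: peak_max.
have [tg|gt] := leP t g.
  have -> : pos (Num.min b t) = t.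
    have [bt|tb] := leP b t; last exact: pos_id.
    case: (eqVneq b t) => [-> //|bNt]; first exact: pos_id.
    have {bNt}bt : b < t by rewrite lt_neqAle bNt.
    have [t_le0|t_gt0] := leP t 0.
      have -> : t = 0 by apply/le_anti; rewrite t0 t_le0.
      by apply: pos_le0; exact: le_trans (ltW bt) _.
    (* The order [b < t] is absurd: on [u, t] both [G] and [H] increase strictly while their sum [D]
       decreases. *)
    pose u := pos b.
    have ut : u < t by rewrite gt_max bt t_gt0.
    have u0 : 0 <= u by exact: pos_ge0.
    have bu : b <= u by rewrite le_max lexx.
    have := (Db u t u0 ut).2 bu; have := (Gg u t u0 ut).1 tg.
    have := (Ht u t u0 ut).1 (lexx t); rewrite !DE; lra.
  rewrite [pos (g - t)]pos_id ?subr_ge0 // subrKC lerD ?HT //.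
  by rewrite -(pos_id _ _ (le_trans t0 tg)); exact: peak_max.
(* Beyond [t] both [G] and [H] decrease, so [D] cannot increase from [t] up to [b]. *)
have bt : b <= t.
  rewrite leNgt; apply/negP => tb.
  have := (Db t b t0 tb).1 (lexx b); have := (Gg t b t0 tb).2 (ltW gt).
  have := (Ht t b t0 tb).2 (lexx t); rewrite !DE; lra.
rewrite [pos (g - t)]pos_le0 ?subr_le0 ?(ltW gt) // addr0 min_l // -DE.
have [pt|tp] := leP p t; last first.
  apply: le_trans (peak_max Db p0); rewrite DE lerD2r.
  by apply: (peak_decr Gg) => //; exact: ltW (lt_trans gt tp).
have [st|ts] := leP s t.
  apply: le_trans (peak_max Db s0); rewrite DE lerD2l.
  exact: (peak_incr Ht).
apply: le_trans (peak_max Db t0); rewrite DE lerD ?HT //.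
by apply: (peak_decr Gg); rewrite // ltW.
Qed.

(** * Unimodality from the sign of the derivative, and derivatives of logarithmic sums *)

Lemma peak_of_derive {R : realType} {f : R -> R} {x : R} (df : R -> R) :
  (forall y : R, 0 <= y -> is_derive y 1 f (df y)) ->
  (forall y : R, 0 < y -> y < x -> 0 < df y) ->
  (forall y : R, 0 < y -> x < y -> df y < 0) -> peak f x.
Proof.
move=> fE df_gt0 df_lt0 u v u0 uv.
have [||c] := MVT uv (df := df) (f := f).
- move=> y; rewrite in_itv /= => /andP[uy _]; apply: fE.
  exact: le_trans u0 (ltW uy).
- apply: derivable_within_continuous => y; rewrite in_itv /= => /andP[uy _].
  by have [] := fE y (le_trans u0 uy).
(* The mean value point [c] is interior, hence positive even when [u = 0]; signs of [df] at positive
   points suffice. *)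
rewrite in_itv /= => /andP[uc cv] E; have c0 := le_lt_trans u0 uc.
have vu : 0 < v - u by rewrite subr_gt0.
split=> [vx|xu].
  by rewrite -subr_gt0 E mulr_gt0 // df_gt0 // (lt_le_trans cv).
by rewrite -subr_lt0 E pmulr_llt0 // df_lt0 // (le_lt_trans xu).
Qed.

Lemma is_derive_ln_affine {R : realType} (a x : R) : 0 < 1 + a * x ->
  is_derive x 1 (fun y => ln (1 + a * y)) (a / (1 + a * x)).
Proof.
move=> h; rewrite mulrC.
apply: (@is_derive1_comp _ (@ln R) (fun y => 1 + a * y)).
  exact: is_derive1_ln.
have -> : (fun y : R => 1 + a * y) = cst 1 + (a \*: (@id R)) by [].
by apply: is_derive_eq; rewrite add0r /GRing.scale /= mulr1.
Qed.

(** A single shape, three logarithms and a linear term, serves all the peaks below; absent terms get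
    coefficient 0. *)
Lemma is_derive_ln_comb {R : realType} (k1 k2 k3 k4 b c a x : R) :
  0 <= b -> 0 <= c -> 0 <= a -> 0 <= x ->
  is_derive x 1
    (fun y => k1 * ln (1 + b * y) + k2 * ln (1 + c * y) + k3 * ln (1 + a * y)
              + k4 * y)
    (k1 * (b / (1 + b * x)) + k2 * (c / (1 + c * x)) + k3 * (a / (1 + a * x))
     + k4).
Proof.
move=> b0 c0 a0 x0.
have d e : 0 <= e -> is_derive x 1 (fun y => ln (1 + e * y)) (e / (1 + e * x)).
  by move=> e0; apply: is_derive_ln_affine; rewrite ltr_wpDr ?mulr_ge0.
have db := d b b0; have dc := d c c0; have da := d a a0.
have -> : (fun y : R => k1 * ln (1 + b * y) + k2 * ln (1 + c * y)
    + k3 * ln (1 + a * y) + k4 * y)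
  = (k1 \*: (fun y : R => ln (1 + b * y))) + (k2 \*: (fun y : R => ln (1 + c * y)))
    + (k3 \*: (fun y : R => ln (1 + a * y))) + (k4 \*: (@id R)) by [].
by apply: is_derive_eq; rewrite /GRing.scale /= mulr1.
Qed.

(** * Sign of a monic quadratic on the positive half-line *)

Section Quadratic.
Variables (R : realType) (p q x : R).
Let r := 2^-1 * (- p + Num.sqrt (p ^+ 2 - 4 * q)).
Hypotheses (disc0 : 0 <= p ^+ 2 - 4 * q) (pq : 0 <= p \/ q <= 0) (x0 : 0 < x).

Let factor : x ^+ 2 + p * x + q = (x - r) * (x + p + r).
Proof. by have := sqr_sqrtr disc0; rewrite /r; nra. Qed.

(** The smaller root [- p - r] is nonpositive, since the square root is at least [- p]: trivially if
    [0 <= p], and by comparison with |p| if [q <= 0]. So for positive [x] only the larger root [r]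
    decides the sign. *)
Let cofactor_gt0 : 0 < x + p + r.
Proof.
suff : - p <= Num.sqrt (p ^+ 2 - 4 * q) by rewrite /r; move: x0; lra.
case: pq => [p0|q0].
  by apply: le_trans (sqrtr_ge0 _); rewrite oppr_le0.
apply: le_trans (ler_norm _) _; rewrite normrN -sqrtr_sqr ler_sqrt //; lra.
Qed.

Lemma quadratic_lt0 : x < r -> x ^+ 2 + p * x + q < 0.
Proof. by move=> xr; rewrite factor pmulr_llt0 // subr_lt0. Qed.

Lemma quadratic_gt0 : r < x -> 0 < x ^+ 2 + p * x + q.
Proof. by move=> xr; rewrite factor mulr_gt0 // subr_gt0. Qed.
End Quadratic.

(** The product of the roots is [q < 0], so the larger one is positive. *)
Lemma quadratic_root_gt0 (R : realType) (p q : R) :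
  q < 0 -> 0 < 2^-1 * (- p + Num.sqrt (p ^+ 2 - 4 * q)).
Proof.
move=> q0; rewrite mulr_gt0 ?invr_gt0 // addrC subr_gt0.
apply: le_lt_trans (ler_norm p) _; rewrite -sqrtr_sqr ltr_sqrt; last first.
  by apply: ltr_pwDr; rewrite ?sqr_ge0 //; lra.
lra.
Qed.

(** * The Lagrangian on a single sub-channel *)

Definition common_rate {R : realType} (w0 m b a s : R) : R :=
  w0 * (m * ln (1 + b * s) + (1 - m) * ln (1 + a * s)).

(** Both rates are in nats and without the factor 1/2; [obj3E] restores the two constants. On a
    sub-channel of S_i, [b] is the lower gain of user i, [a] and [c] are the lower and upper gains
    of the other user, and [m] is mu_i. *)
Definition secret_rate {R : realType} (wi b c p : R) : R :=
  wi * (ln (1 + b * p) - ln (1 + c * p)).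

Section Channel.
Context {R : realType} {a b c m w0 wi lam : R}.
Hypotheses (a0 : 0 < a) (b0 : 0 < b) (c0 : 0 < c).
Hypotheses (m0 : 0 <= m) (m1 : m <= 1).
Hypotheses (w00 : 0 < w0) (wi0 : 0 < wi) (lam0 : 0 < lam).

Let A := a^-1.
Let B := b^-1.
Let C := c^-1.
Let K := w0 / lam.
(** This makes m/(B+s) + (1-m)/(A+s) equal to (s+E)/((A+s)(B+s)), which is the derivative of [com]
    divided by [w0]. *)
Let E := m * A + (1 - m) * B.
Let r := wi / w0.
Let d := C - B.

Let A0 : 0 < A. Proof. by rewrite invr_gt0. Qed.
Let B0 : 0 < B. Proof. by rewrite invr_gt0. Qed.
Let C0 : 0 < C. Proof. by rewrite invr_gt0. Qed.
Let r0 : 0 < r. Proof. by rewrite divr_gt0. Qed.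

Let E0 : 0 < E.
Proof.
rewrite /E; have [->|mN1] := eqVneq m 1; first by rewrite subrr mul0r addr0 mul1r.
by rewrite ltr_wpDl ?mulr_ge0 ?(ltW A0) // mulr_gt0 // subr_gt0 lt_neqAle mN1.
Qed.

Local Notation com := (common_rate w0 m b a).
Local Notation sec := (secret_rate wi b c).

Let aff_neq0 (e x : R) : 0 < e -> 0 <= x -> 1 + e * x != 0.
Proof. by move=> e0 x0; apply/lt0r_neq0/ltr_wpDr; rewrite // mulr_ge0 // ltW. Qed.

Let aff_gt0 (e x : R) : 0 < e -> 0 <= x -> 0 < 1 + e * x.
Proof. by move=> e0 x0; apply/ltr_wpDr; rewrite // mulr_ge0 // ltW. Qed.

Lemma com_incr (x y : R) : 0 <= x -> x <= y -> com x <= com y.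
Proof.
move=> x0 xy; rewrite /common_rate ler_wpM2l ?(ltW w00) //.
have L e : 0 < e -> ln (1 + e * x) <= ln (1 + e * y).
  move=> e0; rewrite ler_ln ?posrE ?aff_gt0 // ?(le_trans x0) //.
  by rewrite lerD2l ler_wpM2l // ltW.
by rewrite lerD // ler_wpM2l ?subr_ge0 // L.
Qed.

(** The derivative is a negative factor times a monic quadratic, whose discriminant is a convex
    combination of two squares. *)
Lemma peak_com :
  peak (fun s => com s - lam * s)
    (2^-1 * (- (A + B - K)
             + Num.sqrt ((A + B - K) ^+ 2 - 4 * (A * B - K * E)))).
Proof.
have disc : 0 <= (A + B - K) ^+ 2 - 4 * (A * B - K * E).
  have -> : (A + B - K) ^+ 2 - 4 * (A * B - K * E)
      = m * (A - B + K) ^+ 2 + (1 - m) * (A - B - K) ^+ 2 by rewrite /E; ring.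
  by apply: addr_ge0; apply: mulr_ge0; rewrite ?sqr_ge0 ?subr_ge0.
(* If [K > A + B], then KE >= (A+B)E >= AB, so the constant term is nonpositive. *)
have pq : 0 <= A + B - K \/ A * B - K * E <= 0.
  have [?|?] := leP 0 (A + B - K); [by left|right].
  have : (A + B) * E = A * B + m * A ^+ 2 + (1 - m) * B ^+ 2 by rewrite /E; ring.
  have : 0 <= m * A ^+ 2 by rewrite mulr_ge0 ?sqr_ge0.
  have : 0 <= (1 - m) * B ^+ 2 by rewrite mulr_ge0 ?sqr_ge0 ?subr_ge0.
  have : 0 <= (K - A - B) * E by rewrite mulr_ge0 ?(ltW E0) //; lra.
  lra.
pose df x : R := (w0 * m) * (b / (1 + b * x)) + (w0 * (1 - m)) * (a / (1 + a * x))
                 + 0 * (a / (1 + a * x)) + - lam.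
have dfE x : 0 <= x -> df x = - (lam * a * b / ((1 + a * x) * (1 + b * x)))
    * (x ^+ 2 + (A + B - K) * x + (A * B - K * E)).
  move=> x0; rewrite /df /K /E /A /B; field.
  by rewrite !aff_neq0 ?lt0r_neq0.
have den x : 0 <= x -> - (lam * a * b / ((1 + a * x) * (1 + b * x))) < 0.
  by move=> x0; rewrite oppr_lt0 divr_gt0 ?mulr_gt0 ?aff_gt0.
apply: (peak_of_derive df) => [y y0|y y0 yx|y y0 yx].
- have := is_derive_ln_comb (w0 * m) (w0 * (1 - m)) 0 (- lam) b a a y
    (ltW b0) (ltW a0) (ltW a0) y0.
  congr (is_derive _ _ _ _); apply: funext => z; rewrite /common_rate; ring.
- by rewrite dfE ?ltW // nmulr_rgt0 ?den ?ltW // quadratic_lt0.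
- by rewrite dfE ?ltW // nmulr_rlt0 ?den ?ltW // quadratic_gt0.
Qed.

(** For a single user the derivative changes sign through the linear factor K - A - x. The quadratic
    of [peak_com] at [m = 0] would give max(K - A, -B) instead, so [gamma] is obtained directly. *)
Lemma peak_com_single : peak (fun s => w0 * ln (1 + a * s) - lam * s) (K - A).
Proof.
pose df x : R := w0 * (a / (1 + a * x)) + 0 * (a / (1 + a * x))
                 + 0 * (a / (1 + a * x)) + - lam.
have dfE x : 0 <= x -> df x = lam * a / (1 + a * x) * (K - A - x).
  by move=> x0; rewrite /df /K /A; field; rewrite !aff_neq0 ?lt0r_neq0.
have den x : 0 <= x -> 0 < lam * a / (1 + a * x).
  by move=> x0; rewrite divr_gt0 ?mulr_gt0 ?aff_gt0.
apply: (peak_of_derive df) => [y y0|y y0 yx|y y0 yx].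
- have := is_derive_ln_comb w0 0 0 (- lam) a a a y
    (ltW a0) (ltW a0) (ltW a0) y0.
  congr (is_derive _ _ _ _); apply: funext => z; ring.
- by rewrite dfE ?ltW // pmulr_rgt0 ?den ?ltW // subr_gt0.
- by rewrite dfE ?ltW // pmulr_rlt0 ?den ?ltW // subr_lt0.
Qed.

Hypotheses (ac : a <= c) (cb : c < b).

Let CA : C <= A. Proof. by rewrite lef_pV2. Qed.
Let d0 : 0 < d. Proof. by rewrite subr_gt0 ltf_pV2. Qed.
Let EA : E <= A.
Proof.
have : 0 <= (1 - m) * (A - B).
  by rewrite mulr_ge0 ?subr_ge0 //; move: CA d0; rewrite /d; lra.
by rewrite /E; lra.
Qed.

Lemma peak_sec :
  peak (fun p => sec p - lam * p)
    (2^-1 * (- (C + B)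
             + Num.sqrt ((C + B) ^+ 2 - 4 * (C * B - wi / lam * d)))).
Proof.
have disc : 0 <= (C + B) ^+ 2 - 4 * (C * B - wi / lam * d).
  have -> : (C + B) ^+ 2 - 4 * (C * B - wi / lam * d)
      = d ^+ 2 + 4 * (wi / lam * d) by rewrite /d; ring.
  by rewrite addr_ge0 ?sqr_ge0 // !mulr_ge0 ?invr_ge0 ?(ltW wi0) ?ltW.
have pq : 0 <= C + B \/ C * B - wi / lam * d <= 0.
  by left; rewrite addr_ge0 ?ltW.
pose df x : R := wi * (b / (1 + b * x)) + - wi * (c / (1 + c * x))
                 + 0 * (b / (1 + b * x)) + - lam.
have dfE x : 0 <= x -> df x = - (lam * b * c / ((1 + b * x) * (1 + c * x)))
    * (x ^+ 2 + (C + B) * x + (C * B - wi / lam * d)).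
  move=> x0; rewrite /df /d /C /B; field.
  by rewrite !aff_neq0 ?lt0r_neq0.
have den x : 0 <= x -> - (lam * b * c / ((1 + b * x) * (1 + c * x))) < 0.
  by move=> x0; rewrite oppr_lt0 divr_gt0 ?mulr_gt0 ?aff_gt0.
apply: (peak_of_derive df) => [y y0|y y0 yx|y y0 yx].
- have := is_derive_ln_comb wi (- wi) 0 (- lam) b c b y
    (ltW b0) (ltW c0) (ltW b0) y0.
  congr (is_derive _ _ _ _); apply: funext => z; rewrite /secret_rate; ring.
- by rewrite dfE ?ltW // nmulr_rgt0 ?den ?ltW // quadratic_lt0.
- by rewrite dfE ?ltW // nmulr_rlt0 ?den ?ltW // quadratic_gt0.
Qed.

(** With [qr], the coefficients of (x+C)(x+E) - rd(x+A), the numerator of the difference of the two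
    marginal rates up to a negative factor. *)
Let pr := C + E - r * d.
Let qr := C * E - r * d * A.

(** If [qr < 0] the quadratic has exactly one positive root. If [qr >= 0], then [pr >= 0] as well,
    the difference decreases from the start, and its peak is 0. *)
Lemma peak_sec_com :
  peak (fun p => sec p - com p)
    (if qr < 0 then 2^-1 * (- pr + Num.sqrt (pr ^+ 2 - 4 * qr)) else 0).
Proof.
pose df x : R := (wi - w0 * m) * (b / (1 + b * x)) + - wi * (c / (1 + c * x))
                 + - (w0 * (1 - m)) * (a / (1 + a * x)) + 0.
have dfE x : 0 <= x ->
    df x = - (w0 * a * b * c / ((1 + a * x) * (1 + b * x) * (1 + c * x)))
      * (x ^+ 2 + pr * x + qr).
  move=> x0; rewrite /df /pr /qr /E /r /d /C /B /A; field.
  by rewrite !aff_neq0 ?lt0r_neq0.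
have den x : 0 <= x ->
    - (w0 * a * b * c / ((1 + a * x) * (1 + b * x) * (1 + c * x))) < 0.
  by move=> x0; rewrite oppr_lt0 divr_gt0 ?mulr_gt0 ?aff_gt0.
apply: (peak_of_derive df) => [y y0|y y0|y y0].
- have := is_derive_ln_comb (wi - w0 * m) (- wi) (- (w0 * (1 - m))) 0 b c a y
    (ltW b0) (ltW c0) (ltW a0) y0.
  congr (is_derive _ _ _ _); apply: funext => z; rewrite /secret_rate /common_rate; ring.
- case: ifPn => [q0 yx|_ yx]; last by move: (lt_trans y0 yx); rewrite ltxx.
  rewrite dfE ?ltW // nmulr_rgt0 ?den ?ltW // quadratic_lt0 //.
    by have := sqr_ge0 pr; lra.
  by right; exact: ltW.
- case: ifPn => [q0 yx|]; rewrite dfE ?ltW // nmulr_rlt0 ?den ?ltW //.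
    rewrite quadratic_gt0 //; last by right; exact: ltW.
    by have := sqr_ge0 pr; lra.
  rewrite -leNgt => q0 _; rewrite ltr_wpDr // ltr_pwDl ?exprn_gt0 //.
  (* Multiplied by A > 0: [r d A <= C E <= A C <= A (C + E)]. *)
  have : C * E <= C * A by rewrite ler_wpM2l // ltW.
  have : 0 < E * A by rewrite mulr_gt0.
  have : pr * A = C * A + E * A - r * d * A by rewrite /pr; ring.
  move: q0; rewrite /qr => q0 prA EA0 CEA.
  have : 0 <= pr * A by lra.
  by rewrite pmulr_lge0 // => ?; rewrite mulr_ge0 // ltW.
Qed.

(** As a polynomial in rd > 0 the discriminant has leading coefficient 1 and nonnegative other
    coefficients, because [C] and [E] are both at most [A]. *)
Lemma secure_disc_gt0 : 0 < pr ^+ 2 - 4 * qr.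
Proof.
have -> : pr ^+ 2 - 4 * qr
    = (r * d) ^+ 2 + 2 * (r * d) * (2 * A - C - E) + (C - E) ^+ 2.
  by rewrite /pr /qr; ring.
have rd0 : 0 < r * d by rewrite mulr_gt0.
rewrite ltr_wpDr ?sqr_ge0 // ltr_wpDr ?exprn_gt0 //.
apply: mulr_ge0; last by move: CA EA; lra.
by rewrite mulr_ge0 ?ler0n ?ltW.
Qed.

Lemma channel_max (g t bt x0 x y : R) :
  peak (fun s => com s - lam * s) g -> peak (fun p => sec p - com p) t ->
  peak (fun p => sec p - lam * p) bt ->
  0 <= t -> 0 <= x0 -> 0 <= x -> 0 <= y ->
  com (x0 + x + y) - com (x + y) + sec x - lam * (x0 + x + y)
  <= com (pos (g - t) + pos (Num.min bt t)) - com (pos (Num.min bt t))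
     + sec (pos (Num.min bt t)) - lam * (pos (g - t) + pos (Num.min bt t)).
Proof.
move=> gP tP btP t0 x00 xx y0.
have xs : x <= x0 + x + y by lra.
have DE z : sec z - lam * z = (com z - lam * z) + (sec z - com z) by ring.
have := peak_split_max gP tP btP DE t0 xx xs.
rewrite [pos (Num.min bt t) + _]addrC.
(* The power [y] of the other confidential message earns no secrecy rate here and only adds to the
   interference on the common message. *)
have : com x <= com (x + y) by apply: com_incr => //; lra.
lra.
Qed.
End Channel.

(** Multiplying by abc turns the sign of the constant coefficient [qr] into the threshold test on
    w_i/w_0. *)
Lemma secure_condition {R : realType} (a b c m r : R) :
  0 < a -> 0 < b -> 0 < c -> c < b ->
  (c^-1 * (m * a^-1 + (1 - m) * b^-1) - r * (c^-1 - b^-1) * a^-1 < 0)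
  = ((m * b + (1 - m) * a) / (b - c) < r).
Proof.
move=> a0 b0 c0 cb.
have -> : c^-1 * (m * a^-1 + (1 - m) * b^-1) - r * (c^-1 - b^-1) * a^-1
    = (a * b * c)^-1 * ((m * b + (1 - m) * a) - r * (b - c)).
  by field; rewrite !lt0r_neq0.
by rewrite pmulr_rlt0 ?invr_gt0 ?mulr_gt0 // subr_lt0 ltr_pdivrMr // subr_gt0.
Qed.

(** * Decomposition over sub-channels and optimality of a common form of allocation *)

Section Optimality.
Context {R : realType} {L : nat} {w0 : R} {w : user -> R}
  {am ap : user -> 'I_L -> R}.
Hypotheses (hw0 : 0 < w0) (hw : forall i, 0 < w i)
  (ham : forall i l, 0 < am i l) (hamap : forall i l, am i l <= ap i l).

Let hap i l : 0 < ap i l. Proof. exact: lt_le_trans (ham i l) (hamap i l). Qed.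
Let ln2_gt0 : 0 < ln 2%:R :> R. Proof. by rewrite ln_gt0 // ltr1n. Qed.

Local Notation better := (better am ap).
Local Notation com mu l := (common_rate w0 mu (am User1 l) (am User2 l)).
Local Notation sec i l := (secret_rate (w i) (am i l) (ap (other i) l)).

Lemma mu_other (mu : R) i : mu_ mu (other i) = 1 - mu_ mu i.
Proof. by case: i => //=; rewrite subKr. Qed.

Lemma common_rate_user mu i l s :
  common_rate w0 (mu_ mu i) (am i l) (am (other i) l) s = com mu l s.
Proof. by rewrite /common_rate -mu_other; case: i => //=; rewrite addrC. Qed.

Lemma better_other {i l} : l \in better i -> l \notin better (other i).
Proof.
rewrite !inE -leNgt => h; apply: le_trans (hamap _ _) _; apply: le_trans (ltW h) _.
by case: i {h} => /=.
Qed.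

Definition own_rate (i : user) (l : 'I_L) (p : R) : R :=
  if l \in better i then sec i l p else 0.

Definition channel (mu : R) (l : 'I_L) (x0 x1 x2 : R) : R :=
  com mu l (x0 + x1 + x2) - com mu l (x1 + x2)
  + own_rate User1 l x1 + own_rate User2 l x2.

Lemma obj3E mu p :
  obj3 am ap w0 w mu p = (2 * ln 2%:R)^-1 *
    \sum_(l < L) channel mu l (common p l) (conf p User1 l) (conf p User2 l).
Proof.
have R0E i : R0max am i p = (2 * ln 2%:R)^-1 * \sum_(l < L)
    (ln (1 + am i l * (common p l + conf p User1 l + conf p User2 l))
     - ln (1 + am i l * (conf p User1 l + conf p User2 l))).
  rewrite /R0max invfM -mulrA [in RHS]mulr_sumr; congr (_ * _).
  by apply: eq_bigr => l _; rewrite /log2 mulrBr !(mulrC (ln 2%:R)^-1).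
have RE i : w i * Rmax am ap i p
    = (2 * ln 2%:R)^-1 * \sum_(l < L) own_rate i l (conf p i l).
  rewrite /Rmax mulrCA invfM -mulrA; congr (_ * _).
  rewrite big_mkcond !mulr_sumr; apply: eq_bigr => l _.
  rewrite /own_rate /secret_rate; case: ifP => _; last by rewrite !mulr0.
  by rewrite /log2; ring.
rewrite /obj3 !RE !R0E.
set k := (2 * ln 2%:R)^-1.
transitivity (k * (w0 * (mu * \sum_(l < L)
      (ln (1 + am User1 l * (common p l + conf p User1 l + conf p User2 l))
       - ln (1 + am User1 l * (conf p User1 l + conf p User2 l)))
    + (1 - mu) * \sum_(l < L)
      (ln (1 + am User2 l * (common p l + conf p User1 l + conf p User2 l))
       - ln (1 + am User2 l * (conf p User1 l + conf p User2 l))))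
    + \sum_(l < L) own_rate User1 l (conf p User1 l)
    + \sum_(l < L) own_rate User2 l (conf p User2 l))); first by ring.
congr (k * _); rewrite !mulr_sumr -big_split mulr_sumr -!big_split /=.
by apply: eq_bigr => l _; rewrite /channel /common_rate; ring.
Qed.

(* [lam] is the price of power in nats; the paper's is [lam / (2 ln 2)]. *)
Lemma lagrangian_sufficiency {mu lam P : R} {p : power_vector R L} :
  (forall l x0 x1 x2, 0 <= x0 -> 0 <= x1 -> 0 <= x2 ->
    channel mu l x0 x1 x2 - lam * (x0 + x1 + x2)
    <= channel mu l (common p l) (conf p User1 l) (conf p User2 l)
       - lam * (common p l + conf p User1 l + conf p User2 l)) ->
  0 <= lam -> feasible P p -> total_power p = P ->
  is_solution P (obj3 am ap w0 w mu) p.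
Proof.
move=> pmax lam0 pP pE; split=> // q [q0 [qi0 qP]].
rewrite !obj3E ler_wpM2l ?invr_ge0 ?mulr_ge0 ?(ltW ln2_gt0) //.
have := ler_sum (index_enum 'I_L) (P := xpredT) (fun l _ =>
  pmax l _ _ _ (q0 l) (qi0 User1 l) (qi0 User2 l)).
rewrite !sumrB -!mulr_sumr -/(total_power q) -/(total_power p) pE => H.
have : lam * total_power q <= lam * P by rewrite ler_wpM2l.
by move: H; lra.
Qed.

Definition secure_level (mu : R) (i : user) (l : 'I_L) : R :=
  if above_mu am ap w0 w mu i l then xi am ap w0 w mu i l else 0.

(** The shape shared by all the allocations. Level 0 encodes the branch below the threshold: the
    confidential power vanishes and the common power is the positive part of [g]. *)
Definition level_alloc (mu lam : R) (g : user -> 'I_L -> R) : power_vector R L :=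
  let t := secure_level mu in
  PowerVector
    (by_part am ap (fun i l => pos (g i l - t i l)) (fun l => pos (g User1 l)))
    (on_own_part am ap (fun i l => pos (Num.min (beta am ap w lam i l) (t i l)))).

Section Level.
Variables (mu : R).
Hypotheses (mu0 : 0 <= mu) (mu1 : mu <= 1).

Let m0 i : 0 <= mu_ mu i. Proof. by case: i => //=; rewrite subr_ge0. Qed.
Let m1 i : mu_ mu i <= 1. Proof. by case: i => //=; rewrite lerBlDr lerDl. Qed.

Let A i l := (am (other i) l)^-1.
Let B i l := (am i l)^-1.
Let C i l := (ap (other i) l)^-1.
Let E i l := mu_ mu i * A i l + (1 - mu_ mu i) * B i l.
Let pr i l := C i l + E i l - w i / w0 * (C i l - B i l).
Let qr i l := C i l * E i l - w i / w0 * (C i l - B i l) * A i l.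

Lemma LambdaE i l : Lambda am ap w0 w mu i l = pr i l ^+ 2 - 4 * qr i l.
Proof.
rewrite /Lambda /delta mu_other /pr /qr /E.
by rewrite -/(A i l) -/(B i l) -/(C i l); ring.
Qed.

Lemma Lambda_gt0 i l : l \in better i -> 0 < Lambda am ap w0 w mu i l.
Proof. by rewrite LambdaE inE => lS; apply: secure_disc_gt0. Qed.

Lemma secure_levelE i l : l \in better i ->
  secure_level mu i l = if qr i l < 0
    then 2^-1 * (- pr i l + Num.sqrt (pr i l ^+ 2 - 4 * qr i l)) else 0.
Proof.
rewrite inE => lS; rewrite /secure_level /above_mu /qr secure_condition //.
rewrite mu_other; case: ifP => // _; rewrite /xi LambdaE /pr /qr /E /delta.
rewrite -/(A i l) -/(B i l) -/(C i l); congr (_ * (_ + _)); ring.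
Qed.

Lemma secure_level_ge0 i l : l \in better i -> 0 <= secure_level mu i l.
Proof.
move=> lS; rewrite secure_levelE //.
by case: ifP => // q0; exact/ltW/quadratic_root_gt0.
Qed.

Lemma channel_level_max (lam : R) i l (g x0 x y : R) :
  0 < lam -> l \in better i ->
  peak (fun s => com mu l s - 2 * lam * ln 2%:R * s) g ->
  0 <= x0 -> 0 <= x -> 0 <= y ->
  let t := secure_level mu i l in
  let p0 := pos (g - t) in
  let p := pos (Num.min (beta am ap w lam i l) t) in
  com mu l (x0 + x + y) - com mu l (x + y) + sec i l x
    - 2 * lam * ln 2%:R * (x0 + x + y)
  <= com mu l (p0 + p) - com mu l p + sec i l p - 2 * lam * ln 2%:R * (p0 + p).
Proof.
move=> lam0 lS gP x00 xx y0 /=.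
have lam'0 : 0 < 2 * lam * ln 2%:R by rewrite !mulr_gt0.
have comE := funext (common_rate_user mu i l).
rewrite -comE in gP *.
(* [beta] is recast as the larger root in [peak_sec], at price [2 * lam * ln 2]. *)
have bt : beta am ap w lam i l = 2^-1 * (- (C i l + B i l)
    + Num.sqrt ((C i l + B i l) ^+ 2
        - 4 * (C i l * B i l - w i / (2 * lam * ln 2%:R) * (C i l - B i l)))).
  rewrite /beta [RHS]mulrDr mulrN [RHS]addrC; congr (_ * Num.sqrt _ - _).
  rewrite /delta -/(B i l) -/(C i l); field.
  by rewrite !lt0r_neq0.
have t0 := secure_level_ge0 i l lS.
move: lS; rewrite bt inE => lS; apply: channel_max => //.
  rewrite secure_levelE ?inE //; exact: peak_sec_com.
exact: peak_sec.
Qed.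

Lemma level_alloc_optimal (lam P : R) (g : user -> 'I_L -> R) :
  0 < lam ->
  (forall i l, peak (fun s => com mu l s - 2 * lam * ln 2%:R * s) (g i l)) ->
  total_power (level_alloc mu lam g) = P ->
  is_solution P (obj3 am ap w0 w mu) (level_alloc mu lam g).
Proof.
move=> lam0 gP.
have lam'0 : 0 < 2 * lam * ln 2%:R by rewrite !mulr_gt0.
move=> pE; apply: (lagrangian_sufficiency _ (ltW lam'0) _ pE); last first.
  split; [|split; last by rewrite pE].
    by move=> l; rewrite /= /by_part; do 2?case: ifP => _; exact: pos_ge0.
  by move=> i l; rewrite /= /on_own_part; case: ifP => _ //; exact: pos_ge0.
move=> l x0 x1 x2 x00 x10 x20.
rewrite /channel /own_rate /= /by_part /on_own_part.
case: (boolP (l \in better User1)) => l1.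
  rewrite (negPf (better_other l1)) !addr0.
  exact: (channel_level_max lam User1 l (g User1 l) x0 x1 x2).
case: (boolP (l \in better User2)) => l2.
  (* On S_2 the confidential powers exchange roles, so the sums are reordered. *)
  rewrite !addr0 !add0r [x1 + x2]addrC -[x0 + x1 + x2]addrA [x1 + x2]addrC !addrA.
  exact: (channel_level_max lam User2 l (g User2 l) x0 x2 x1).
rewrite !addr0.
(* On S_3 confidential power only causes interference, and the total power is best placed at the
   peak of the common rate. *)
have : com mu l 0 <= com mu l (x1 + x2) by apply: com_incr; rewrite ?addr_ge0.
have s0 : 0 <= x0 + x1 + x2 by rewrite !addr_ge0.
by have := peak_max (gP User1 l) s0; lra.
Qed.

Lemma peak_nu (lam : R) i l : 0 < lam ->
  peak (fun s => com mu l s - 2 * lam * ln 2%:R * s) (nu am w0 lam mu i l).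
Proof.
move=> lam0; have lam'0 : 0 < 2 * lam * ln 2%:R by rewrite !mulr_gt0.
rewrite -(funext (common_rate_user mu i l)).
have -> : nu am w0 lam mu i l = 2^-1 * (- (A i l + B i l - w0 / (2 * lam * ln 2%:R))
    + Num.sqrt ((A i l + B i l - w0 / (2 * lam * ln 2%:R)) ^+ 2
        - 4 * (A i l * B i l - w0 / (2 * lam * ln 2%:R) * E i l))).
  rewrite /nu [RHS]mulrDr mulrN [RHS]addrC; congr (_ * Num.sqrt _ - _).
  rewrite /E -/(A i l) -/(B i l); field.
  by rewrite !lt0r_neq0.
exact: peak_com.
Qed.
End Level.
End Optimality.

(** * Identification of the closed-form allocations with the common form *)

Section Allocations.
Context {R : realType} {L : nat} {w0 : R} {w : user -> R}
  {am ap : user -> 'I_L -> R}.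
Hypotheses (hw0 : 0 < w0) (hw : forall i, 0 < w i)
  (ham : forall i l, 0 < am i l) (hamap : forall i l, am i l <= ap i l).

Let ln2_gt0 : 0 < ln 2%:R :> R. Proof. by rewrite ln_gt0 // ltr1n. Qed.

Local Notation better := (better am ap).
Local Notation com mu l := (common_rate w0 mu (am User1 l) (am User2 l)).
Local Notation level mu := (@secure_level R L w0 w am ap mu).

Lemma pos_min0 (x : R) : pos (Num.min x 0) = 0.
Proof. by rewrite pos_le0 // ge_min lexx orbT. Qed.

(** Positivity of [Lambda] on S_i leaves only the first of the three branches. *)
Lemma alloc3_level (lam mu : R) : 0 <= mu -> mu <= 1 ->
  alloc3 am ap w0 w lam mu
  = @level_alloc R L w0 w am ap mu lam (nu am w0 lam mu).
Proof.
move=> mu0 mu1; rewrite /alloc3 /level_alloc; congr PowerVector.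
  apply: funext => l; rewrite /by_part /secure_level.
  by do 2?case: ifPn => [lS|_] //; rewrite Lambda_gt0 //; case: ifP;
    rewrite ?subr0.
apply: funext => i; apply: funext => l; rewrite /on_own_part /secure_level.
by case: ifPn => // lS; rewrite Lambda_gt0 //; case: ifP => //; rewrite pos_min0.
Qed.

(* The weight mu at which (P3) becomes the problem of user j alone. *)
Definition sole (j : user) : R := match j with User1 => 1 | User2 => 0 end.

Lemma mu_sole j i : mu_ (sole j) i
  = match j, i with User1, User1 | User2, User2 => 1 | _, _ => 0 end.
Proof. by case: j i => [] [] /=; rewrite ?subrr ?subr0. Qed.

Lemma com_sole j l : com (sole j) l = fun s => w0 * ln (1 + am j l * s).
Proof.
apply: funext => s.
by case: j; rewrite /common_rate /= ?subrr ?subr0 !mul1r mul0r ?addr0 ?add0r.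
Qed.

Lemma above_sole j i l : above am ap w0 w j i l = above_mu am ap w0 w (sole j) i l.
Proof.
rewrite /above /above_mu !mu_sole.
by case: j i => [] [] /=; rewrite !mul1r mul0r ?addr0 ?add0r.
Qed.

(** When mu_i = 1, [Lambda] is the square of [zeta] plus 1/alpha_{other i}^-, which is positive, and
    the root simplifies. When mu_i = 0, [Lambda] is [Delta] once the division by [delta] is
    cleared. *)
Lemma crossing_sole j i l : l \in better i ->
  crossing am ap w0 w j i l = xi am ap w0 w (sole j) i l.
Proof.
rewrite inE => lS; have c0 := lt_le_trans (ham (other i) l) (hamap (other i) l).
have d0 : 0 < delta am ap i l.
  by rewrite subr_gt0 ltf_pV2 // posrE.
have ac : (ap (other i) l)^-1 <= (am (other i) l)^-1.
  by rewrite lef_pV2 ?posrE.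
have zetaE mu : mu_ mu i = 1 -> zeta am ap w0 w i l = xi am ap w0 w mu i l.
  move=> mui; rewrite /xi /Lambda mu_other mui.
  set D := (X in Num.sqrt X).
  have -> : D = (w i / w0 * delta am ap i l - (ap (other i) l)^-1
      + (am (other i) l)^-1) ^+ 2 by rewrite /D /delta; ring.
  rewrite sqrtr_sqr ger0_norm /zeta.
    by rewrite /delta; field; rewrite !lt0r_neq0.
  have : 0 < w i / w0 * delta am ap i l by rewrite mulr_gt0 // divr_gt0.
  by move: ac; lra.
have thetaE mu : mu_ mu i = 0 -> theta am ap w0 w i l = xi am ap w0 w mu i l.
  move=> mui; rewrite /xi /Lambda mu_other mui /theta mul0r subr0.
  congr (_ * (_ + Num.sqrt _)).
  rewrite /Delta -/(delta am ap i l) mul0r addr0 subr0.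
  have dN0 := lt0r_neq0 d0.
  rewrite 2!mulrDl mulrA; field.
  by rewrite dN0 !lt0r_neq0.
move: {lS c0 d0 ac} zetaE thetaE (mu_sole j i).
by case: j i => [] [] zE tE mE; (exact: zE || exact: tE).
Qed.

Lemma alloc_level j lam : alloc am ap w0 w j lam
  = @level_alloc R L w0 w am ap (sole j) lam (fun _ => gamma am w0 lam j).
Proof.
rewrite /alloc /level_alloc; congr PowerVector.
  apply: funext => l; rewrite /by_part /secure_level.
  by do 2?case: ifPn => [lS|_] //; rewrite above_sole -crossing_sole //;
    case: ifP; rewrite ?subr0.
apply: funext => i; apply: funext => l; rewrite /on_own_part /secure_level.
case: ifPn => // lS; rewrite above_sole -crossing_sole //.
by case: ifP => //; rewrite pos_min0.
Qed.

Lemma sole_ge0 j : 0 <= sole j. Proof. by case: j. Qed.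
Lemma sole_le1 j : sole j <= 1. Proof. by case: j. Qed.

Lemma alloc_optimal j (lam P : R) : 0 < lam ->
  total_power (alloc am ap w0 w j lam) = P ->
  is_solution P (obj3 am ap w0 w (sole j)) (alloc am ap w0 w j lam).
Proof.
move=> lam0; rewrite alloc_level; apply: level_alloc_optimal => //.
- exact: sole_ge0.
- exact: sole_le1.
- move=> _ l; rewrite com_sole; apply: peak_com_single => //.
  by rewrite !mulr_gt0.
Qed.

Lemma alloc3_optimal (lam mu P : R) : 0 < lam -> 0 <= mu -> mu <= 1 ->
  total_power (alloc3 am ap w0 w lam mu) = P ->
  is_solution P (obj3 am ap w0 w mu) (alloc3 am ap w0 w lam mu).
Proof.
move=> lam0 mu0 mu1; rewrite alloc3_level //; apply: level_alloc_optimal => //.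
by move=> i l; apply: peak_nu.
Qed.

(** * Existence of a multiplier that spends exactly the available power *)

Lemma continuous_pos (f : R -> R) : continuous f -> continuous (fun x => pos (f x)).
Proof. by move=> fc x; apply: continuous_max; [exact: fc|exact: cvg_cst]. Qed.

Lemma continuous_min_cst (f : R -> R) (k : R) :
  continuous f -> continuous (fun x => Num.min (f x) k).
Proof. by move=> fc x; apply: continuous_min; [exact: fc|exact: cvg_cst]. Qed.

Lemma continuous_affine (k h : R) : continuous (fun x : R => k * x + h).
Proof.
move=> x; apply: cvgD; last exact: cvg_cst.
by apply: cvgM; [exact: cvg_cst|exact: cvg_id].
Qed.

(** In x = 1/lambda, [gamma] is affine. The identity includes [x = 0], through the convention
    [0^-1 = 0], and this point plays the part of an infinite price. *)
Lemma gamma_inv j l (x : R) :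
  gamma am w0 x^-1 j l = w0 / (2 * ln 2%:R) * x - (am j l)^-1.
Proof. by rewrite /gamma !invfM invrK; congr (_ - _); ring. Qed.

Lemma beta_inv i l (x : R) : beta am ap w x^-1 i l
  = 2^-1 * Num.sqrt (delta am ap i l * (2 * w i / ln 2%:R) * x
                     + delta am ap i l * delta am ap i l)
    - 2^-1 * ((ap (other i) l)^-1 + (am i l)^-1).
Proof.
rewrite /beta invfM invrK; congr (_ * Num.sqrt _ - _); ring.
Qed.

(** The threshold tests and the crossing levels are independent of lambda, so each sub-channel stays
    in one branch as [x] varies. *)
Lemma alloc_total_continuous j :
  continuous (fun x : R => total_power (alloc am ap w0 w j x^-1)).
Proof.
rewrite /total_power.
pose T l (x : R) := common (alloc am ap w0 w j x^-1) l
  + conf (alloc am ap w0 w j x^-1) User1 l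
  + conf (alloc am ap w0 w j x^-1) User2 l.
apply: (@continuous_big _ _ +%R 0 xpredT _ _ _ T) => [|l _].
  exact: add_continuous.
have gC k : continuous (fun x : R => pos (gamma am w0 x^-1 j l - k)).
  apply: continuous_pos; under eq_fun do rewrite gamma_inv -addrA.
  exact: continuous_affine.
have bC i k : continuous (fun x : R => pos (Num.min (beta am ap w x^-1 i l) k)).
  apply/continuous_pos/continuous_min_cst; under eq_fun do rewrite beta_inv.
  move=> x; apply: cvgB; last exact: cvg_cst.
  apply: cvgM; first exact: cvg_cst.
  apply: (continuous_comp (@continuous_affine _ _ x)).
  exact: sqrt_continuous.
have cC : continuous (fun x : R => common (alloc am ap w0 w j x^-1) l).
  have := gC 0; under eq_fun do rewrite subr0; move=> gC0.
  rewrite /alloc /= /by_part.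
  case: (l \in better User1); last case: (l \in better User2).
  - by case: (above am ap w0 w j User1 l); [exact: gC|exact: gC0].
  - by case: (above am ap w0 w j User2 l); [exact: gC|exact: gC0].
  - exact: gC0.
have sC i : continuous (fun x : R => conf (alloc am ap w0 w j x^-1) i l).
  rewrite /alloc /= /on_own_part.
  case: (l \in better i); last exact: cst_continuous.
  by case: (above am ap w0 w j i l); last exact: cst_continuous.
by move=> x; apply: cvgD; [apply: cvgD; [exact: cC|exact: sC]|exact: sC].
Qed.

(** At [x = 0], [gamma] becomes -1/alpha_j^- and, on S_i, [beta] becomes -1/alpha_i^-; all positive
    parts vanish. *)
Lemma alloc_total0 j : total_power (alloc am ap w0 w j 0^-1) = 0.
Proof.
have t0 i l : l \in better i -> 0 <= level (sole j) i l.
  by move=> lS; apply: secure_level_ge0; rewrite ?sole_ge0 ?sole_le1.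
have g0 l : gamma am w0 0^-1 j l <= 0.
  by rewrite gamma_inv mulr0 add0r oppr_le0 invr_ge0 ltW.
have b0 i l : l \in better i -> beta am ap w 0^-1 i l <= 0.
  rewrite inE => lS; rewrite beta_inv mulr0 add0r -expr2 sqrtr_sqr ger0_norm.
    have := ham i l; rewrite -invr_gt0 /delta; lra.
  rewrite subr_ge0 lef_pV2 ?posrE ?(ltW lS) //.
  exact: lt_le_trans (ham _ _) (hamap _ _).
rewrite alloc_level /total_power big1 // => l _ /=.
have c0 i : on_own_part am ap (fun i l => pos (Num.min (beta am ap w 0^-1 i l)
    (level (sole j) i l))) i l = 0.
  rewrite /on_own_part; case: ifP => // lS.
  by rewrite pos_le0 // ge_min b0.
rewrite !c0 !addr0 /by_part.
by case: ifPn => [lS|_]; [|case: ifPn => [lS|_]]; rewrite pos_le0 //;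
  rewrite subr_le0 (le_trans (g0 l)) ?t0.
Qed.

Lemma alloc_exists j (P : R) : (1 <= L)%N -> 0 < P ->
  exists lam : R, 0 < lam /\ total_power (alloc am ap w0 w j lam) = P.
Proof.
move=> L0 P0; pose l0 := Ordinal L0.
(* [k] is the level subtracted from [gamma] on the first sub-channel. The [x] below makes [gamma]
   equal to [P + k] there, so the common power of this sub-channel alone reaches [P]. *)
pose k := by_part am ap (level (sole j)) (fun=> 0) l0.
have k0 : 0 <= k.
  by rewrite /k /by_part; do 2?case: ifP => //; move=> *;
    apply: secure_level_ge0; rewrite ?sole_ge0 ?sole_le1.
pose x := (P + (am j l0)^-1 + k) * (2 * ln 2%:R) / w0.
have x0 : 0 <= x.
  rewrite /x !mulr_ge0 ?invr_ge0 ?(ltW hw0) ?(ltW ln2_gt0) //.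
  by rewrite !addr_ge0 ?invr_ge0 ?(ltW P0) // ltW.
have xP : P <= total_power (alloc am ap w0 w j x^-1).
  have c0 i l : 0 <= conf (alloc am ap w0 w j x^-1) i l.
    by rewrite /= /on_own_part; do 2?case: ifP => _ //; exact: pos_ge0.
  have cm0 l : 0 <= common (alloc am ap w0 w j x^-1) l.
    by rewrite /= /by_part; do 3?case: ifP => _ //; exact: pos_ge0.
  rewrite /total_power (bigD1 l0) //= -[leLHS]addr0 lerD ?sumr_ge0 //; last first.
    by move=> l _; rewrite !addr_ge0 ?c0 ?cm0.
  apply: le_trans (_ : common (alloc am ap w0 w j x^-1) l0 <= _); last first.
    by rewrite -addrA lerDl addr_ge0 ?c0.
  have gE : gamma am w0 x^-1 j l0 = P + k.
    by rewrite gamma_inv /x; field; rewrite !lt0r_neq0.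
  rewrite alloc_level /= /by_part gE /k /by_part.
  by case: (l0 \in better User1); [|case: (l0 \in better User2)];
    rewrite le_max ?addrK ?addr0 lexx.
have [||c] := @IVT _ (fun x => total_power (alloc am ap w0 w j x^-1)) 0 x P x0.
- exact/continuous_subspaceT/alloc_total_continuous.
- by rewrite alloc_total0 ge_min le_max (ltW P0) xP orbT.
rewrite in_itv /= => /andP[c0 _] cP; exists c^-1; split=> //.
(* The intermediate value is not taken at 0, where the spent power is 0 and not [P]; hence the
   multiplier [c^-1] is positive. *)
rewrite invr_gt0 lt_neqAle c0 andbT; apply/eqP => c00.
by move: cP P0; rewrite -c00 alloc_total0 => <-; rewrite ltxx.
Qed.
End Allocations.

Theorem theorem1 (R : realType) (L : nat) (P w0 : R) (w : user -> R)
    (am ap : user -> 'I_L -> R)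
    (hL : (1 <= L)%N) (hP : 0 < P) (hw0 : 0 < w0) (hw : forall i, 0 < w i)
    (ham : forall i l, 0 < am i l) (hamap : forall i l, am i l <= ap i l) :
  ((exists lam : R,
      0 < lam /\ total_power (alloc am ap w0 w User1 lam) = P) /\
   (forall lam : R,
      0 < lam -> total_power (alloc am ap w0 w User1 lam) = P ->
      is_solution P (obj1 am ap w0 w) (alloc am ap w0 w User1 lam)))
  /\
  ((exists lam : R,
      0 < lam /\ total_power (alloc am ap w0 w User2 lam) = P) /\
   (forall lam : R,
      0 < lam -> total_power (alloc am ap w0 w User2 lam) = P ->
      is_solution P (obj2 am ap w0 w) (alloc am ap w0 w User2 lam)))
  /\
  (forall lam mu : R,
     0 < lam -> 0 < mu -> mu < 1 ->
     total_power (alloc3 am ap w0 w lam mu) = P ->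
     R0max am User1 (alloc3 am ap w0 w lam mu)
       = R0max am User2 (alloc3 am ap w0 w lam mu) ->
     is_solution P (obj3 am ap w0 w mu) (alloc3 am ap w0 w lam mu)).
Proof.
have obj1E : obj1 am ap w0 w = obj3 am ap w0 w 1.
  by apply: funext => p; rewrite /obj1 /obj3 subrr mul0r addr0 mul1r.
have obj2E : obj2 am ap w0 w = obj3 am ap w0 w 0.
  by apply: funext => p; rewrite /obj2 /obj3 subr0 mul0r add0r mul1r.
rewrite obj1E obj2E; split; [|split].
- by split=> [|lam]; [exact: alloc_exists|exact: (alloc_optimal _ _ _ _ User1)].
- by split=> [|lam]; [exact: alloc_exists|exact: (alloc_optimal _ _ _ _ User2)].
- by move=> lam mu lam0 mu0 mu1 pE _; apply: alloc3_optimal; rewrite ?ltW.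
Qed.
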